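(* Let $A\in\mathbb{R}_+^{n\times m}$ with $n\le m$. For $I\subseteq\{1,\dots,m\}$ with $|I|=n$, let $A_I$ denote the $n\times n$ submatrix of $A$ consisting of the columns indexed by $I$. Then $\mathrm{rank}_\theta(A)<n$ if and only if $\mathrm{rank}_\theta(A_I)<n$ for all $I\subseteq\{1,\dots,m\}$ with $|I|=n$.
   Context: $\mathbb{R}_+^{n\times m}$ is the set of real $n\times m$ matrices with nonnegative entries. For $A\in\mathbb{R}_+^{n\times m}$, the phaseless rank is $\mathrm{rank}_\theta(A)=\min\{\mathrm{rank}(B) : B\in\mathbb{C}^{n\times m},\ |B_{ij}|=A_{ij}\text{ for all } i,j\}$. *)

(* Defs.v *)
From HB Require Import structures.
From mathcomp Require Import all_boot all_order all_algebra.
From mathcomp Require Import complex.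
From mathcomp Require Import boolp reals.

Set Implicit Arguments.
Unset Strict Implicit.
Unset Printing Implicit Defensive.

Import Order.TTheory GRing.Theory Num.Theory.
Local Open Scope ring_scope.

Definition nonneg_mx (R : realType) (n m : nat) (A : 'M[R]_(n, m)) : Prop :=
  forall i j, 0 <= A i j.

Definition has_modulus (R : realType) (n m : nat)
    (A : 'M[R]_(n, m)) (B : 'M[R[i]]_(n, m)) : Prop :=
  forall i j, `|B i j| = (A i j)%:C%C.

Definition phaseless_rank_value (R : realType) (n m : nat)
    (A : 'M[R]_(n, m)) : pred nat :=
  fun r => `[< exists2 B : 'M[R[i]]_(n, m), has_modulus A B & \rank B = r >].

(* The minimum is over a nonempty set exactly when A is nonnegative (see
   phaseless_rank_attained and phaseless_rank_le below); the value 0 returned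
   for other matrices carries no meaning. *)
Definition phaseless_rank (R : realType) (n m : nat)
    (A : 'M[R]_(n, m)) : nat :=
  match pselect (exists r, phaseless_rank_value A r) with
  | left ex_r => ex_minn ex_r
  | right _ => 0%N
  end.

Lemma phaseless_rank_attained (R : realType) (n m : nat) (A : 'M[R]_(n, m)) :
  nonneg_mx A ->
  exists2 B : 'M[R[i]]_(n, m), has_modulus A B & \rank B = phaseless_rank A.
Proof.
move=> A_ge0; rewrite /phaseless_rank; case: pselect => [ex_r | []].
  by case: ex_minnP => r /asboolP.
pose B := map_mx (fun x : R => x%:C%C) A.
exists (\rank B); apply/asboolP; exists B => // i j.
by rewrite mxE ger0_norm // lecR.
Qed.

Lemma phaseless_rank_le (R : realType) (n m : nat) (A : 'M[R]_(n, m))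
    (B : 'M[R[i]]_(n, m)) :
  has_modulus A B -> (phaseless_rank A <= \rank B)%N.
Proof.
move=> AB; rewrite /phaseless_rank; case: pselect => // ex_r.
by case: ex_minnP => r _; apply; apply/asboolP; exists B.
Qed.

(* enum_val lists the elements of I in increasing order. *)
Definition col_submx (R : realType) (n m : nat) (A : 'M[R]_(n, m))
    (I : {set 'I_m}) (cardI : #|I| = n) : 'M[R]_n :=
  colsub (fun k : 'I_n => enum_val (cast_ord (esym cardI) k)) A.

(* Main.v *)
Require Import Defs.
From HB Require Import structures.
From mathcomp Require Import all_boot all_order all_algebra.
From mathcomp Require Import complex.
From mathcomp Require Import boolp reals.
From mathcomp Require Import lra.

(** Being phaselessly rank deficient is a linear feasibility problem, to which
    Helly's theorem applies.

    If [B] has moduli [A] and rank less than [n], some nonzero [w] satisfies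
    [w *m B = 0].  Put [x i = `|w i|].  In each column [j] the complex numbers
    [w i * B i j] sum to zero, so none of their moduli [x i * A i j] exceeds the
    sum of the others.  Conversely, nonnegative reals obeying these polygon
    inequalities are the side lengths of a closed polygon in the complex plane
    ([closed_polygon]), so a nonzero nonnegative [x] satisfying them in every
    column yields phases for the entries of [A] that make the rows linearly
    dependent.  This is [phaseless_rank_lt_iff].

    For a given column the polygon inequalities are linear and homogeneous in
    [x]: they cut out a convex cone in the nonnegative orthant of dimension [n].
    Helly's theorem for cones ([conic_helly]) says that when any [n] such cones
    share a nonzero nonnegative vector, all of them do; its number is [n] rather
    than [n + 1] because rays of the orthant form a space of dimension [n - 1].
    It is proved by Radon's argument: [n + 1] vectors in dimension [n] have a
    nontrivial linear relation, and moving its negative terms to the other side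
    writes one vector as two nonnegative combinations over disjoint index
    sets. *)

Set Implicit Arguments.
Unset Strict Implicit.
Unset Printing Implicit Defensive.

Import Order.TTheory GRing.Theory Num.Theory.
Local Open Scope ring_scope.

(** * Helly's theorem for convex cones *)

Definition convex_cone (R : numDomainType) (V : lmodType R) (K : V -> Prop) :=
  [/\ K 0, forall x y, K x -> K y -> K (x + y)
    & forall a x, 0 <= a -> K x -> K (a *: x)].

Lemma convex_cone_sum (R : numDomainType) (V : lmodType R) (K : V -> Prop)
    (T : finType) (P : pred T) (c : T -> R) (p : T -> V) :
  convex_cone K -> (forall j, P j -> 0 <= c j /\ K (p j)) ->
  K (\sum_(j | P j) c j *: p j).
Proof.
by case=> K0 KD KZ cp; elim/big_ind: _ => // j /cp[c_ge0 Kp]; apply: KZ.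
Qed.

Lemma convex_cone_nonneg (R : realType) (n m : nat) :
  convex_cone (@nonneg_mx R n m).
Proof.
split=> [i j|x y x_ge0 y_ge0 i j|a x a_ge0 x_ge0 i j]; rewrite mxE //.
  exact: addr_ge0.
exact: mulr_ge0.
Qed.

Lemma linear_relation (F : fieldType) (n : nat) (T : finType) (J : {set T})
    (p : T -> 'rV[F]_n) :
  (n < #|J|)%N ->
  exists c : T -> F,
    (exists2 j, j \in J & c j != 0) /\ \sum_(j in J) c j *: p j = 0.
Proof.
move=> ltnJ; pose P := \matrix_(k < #|J|) p (enum_val k).
have : kermx P != 0.
  rewrite kermx_eq0 /row_free neq_ltn (leq_ltn_trans _ ltnJ) //.
  exact: rank_leq_col.
case/rowV0Pn=> v /sub_kermxP vP0 /rV0Pn[k vk0].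
have jJ := enum_valP k.
pose c j := v 0 (enum_rank_in jJ j).
have cE l : c (enum_val l) = v 0 l by rewrite /c enum_valK_in.
exists c; split; first by exists (enum_val k); rewrite ?cE.
rewrite big_enum_val -[RHS]vP0 mulmx_sum_row; apply: eq_bigr => l _.
by rewrite cE rowK.
Qed.

(** Only the absence of cancellation is at stake: a nonnegative combination of
    vectors of the orthant vanishes only if each of its terms does. *)
Lemma nonneg_comb_neq0 (R : realType) (n : nat) (T : finType) (P : pred T)
    (c : T -> R) (p : T -> 'rV[R]_n) (k : T) :
  (forall j, P j -> 0 <= c j /\ nonneg_mx (p j)) ->
  P k -> 0 < c k -> p k != 0 -> \sum_(j | P j) c j *: p j != 0.
Proof.
move=> cp Pk ck /rV0Pn[i pki]; apply/rV0Pn; exists i.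
rewrite summxE (bigD1 k) //= mxE gt_eqF // ltr_wpDr //.
  apply: sumr_ge0 => j /andP[/cp[c_ge0 p_ge0] _]; rewrite mxE.
  exact: mulr_ge0.
by rewrite mulr_gt0 // lt_def pki; case: (cp k Pk) => _; apply.
Qed.

(** Radon's theorem for rays of the orthant: [c] is a linear relation among the
    [p j], and its positive and negative parts are two expressions of [q] over
    disjoint sets of indices.  Some [c j] is nonzero, and in whichever part it
    lies the nonnegative vectors cannot cancel, so [q != 0]. *)
Lemma conic_radon (R : realType) (n : nat) (T : finType) (J : {set T})
    (p : T -> 'rV[R]_n) :
  (n < #|J|)%N -> (forall j, j \in J -> p j != 0 /\ nonneg_mx (p j)) ->
  exists (c : T -> R) (q : 'rV[R]_n),
    [/\ q != 0, q = \sum_(j in J | 0 < c j) c j *: p j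
      & q = \sum_(j in J | c j < 0) (- c j) *: p j].
Proof.
move=> /(linear_relation p)[c [[k kJ ck] c_rel]] pJ.
pose q := \sum_(j in J | 0 < c j) c j *: p j.
have qE : q = \sum_(j in J | c j < 0) (- c j) *: p j.
  have -> : \sum_(j in J | c j < 0) - c j *: p j
            = - \sum_(j in J | ~~ (0 < c j)) c j *: p j.
    rewrite -sumrN [RHS](bigID (fun j => c j < 0)) /= [X in _ + X]big1 ?addr0.
      apply: eq_big => [j|j _]; last by rewrite scaleNr.
      by case: ltrgt0P; rewrite ?andbT ?andbF.
    move=> j; case: ltrgt0P => [|| ->]; rewrite ?andbT ?andbF //.
    by rewrite scale0r oppr0.
  apply/eqP; rewrite -addr_eq0 -[X in _ == X]c_rel.
  by rewrite [X in _ == X](bigID (fun j => 0 < c j)).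
exists c, q; split=> //.
case: (ltrgt0P (c k)) ck => // ck _.
  apply: (nonneg_comb_neq0 (k := k)) => //; last by case: (pJ k kJ).
    by move=> j /andP[/pJ[_ pj] /ltW].
  by rewrite kJ.
rewrite qE; apply: (nonneg_comb_neq0 (k := k)) => //; last by case: (pJ k kJ).
- by move=> j /andP[/pJ[_ pj] /ltW]; rewrite oppr_ge0.
- by rewrite kJ.
by rewrite oppr_gt0.
Qed.

(** Induction on the size of the subfamily [J].  Once [J] has more than [n]
    members, choose for each [j] in [J] a common vector [p j] of the other cones
    of [J].  Of the two index sets given by Radon's theorem one avoids [j], so
    one of the two expressions of [q] places it in the cone [K j]. *)
Lemma conic_helly (R : realType) (n : nat) (T : finType)
    (K : T -> 'rV[R]_n -> Prop) :
  (n <= #|T|)%N -> (forall j, convex_cone (K j)) ->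
  (forall I : {set T}, #|I| = n ->
     exists x, [/\ x != 0, nonneg_mx x & forall j, j \in I -> K j x]) ->
  exists x, [/\ x != 0, nonneg_mx x & forall j, K j x].
Proof.
move=> leqnT Kcone Kn.
suff KJ (J : {set T}) : (n <= #|J|)%N ->
    exists x, [/\ x != 0, nonneg_mx x & forall j, j \in J -> K j x].
  have [|x [x0 x_ge0 Kx]] := KJ [set: T]; first by rewrite cardsT.
  by exists x; split=> // j; apply: Kx.
have [k] := ubnP #|J|; elim: k J => // k IHk J; rewrite ltnS => leJk.
rewrite leq_eqVlt => /predU1P[/esym/Kn //|ltnJ].
have /choice[p pP] j : exists x : 'rV[R]_n, j \in J ->
    [/\ x != 0, nonneg_mx x & forall l, l \in J :\ j -> K l x].
  have [jJ|_] := boolP (j \in J); last by exists 0.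
  have cardJ : #|J| = #|J :\ j|.+1 by rewrite (cardsD1 j J) jJ.
  have [||x xP] := IHk (J :\ j); last by exists x.
    by rewrite -cardJ.
  by rewrite -ltnS -cardJ.
have [|c [q [q0 qpos qneg]]] := conic_radon (p := p) ltnJ.
  by move=> j /pP[].
have Kp j l : j \in J -> l \in J -> l != j -> K l (p j).
  by move=> /pP[_ _ Kj] lJ lj; apply: Kj; rewrite !inE lj.
exists q; split=> // [|l lJ].
  rewrite qpos; apply: (convex_cone_sum (convex_cone_nonneg R 1 n)) => j.
  by case/andP=> /pP[_ pj _] /ltW.
have [cl|cl] := ltP 0 (c l).
  rewrite qneg; apply: convex_cone_sum => // j /andP[jJ cj].
  split; first by rewrite oppr_ge0 ltW.
  by apply: Kp => //; apply: contraTneq cl => ->; rewrite -leNgt ltW.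
rewrite qpos; apply: convex_cone_sum => // j /andP[jJ cj].
split; first exact: ltW.
by apply: Kp => //; apply: contraTneq cl => ->; rewrite -ltNge.
Qed.

(** * Closed polygons with prescribed side lengths *)

Lemma normc_real (R : rcfType) (a : R) : 0 <= a -> `|a%:C%C| = a%:C%C.
Proof. by move=> a_ge0; rewrite ger0_norm // lecR. Qed.

Lemma phase_exists (R : rcfType) (z : R[i]) (t : R) :
  `|z| = t%:C%C -> exists2 u : R[i], `|u| = 1 & u * t%:C%C = z.
Proof.
move=> zt; have [z0|z0] := eqVneq z 0.
  by exists 1; rewrite ?normr1 // mul1r -zt z0 normr0.
exists (z / `|z|); first by rewrite normrM normfV normr_id divff // normr_eq0.
by rewrite -zt divfK // normr_eq0.
Qed.

(** Heron's construction of a triangle: with one side on the real axis from [0]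
    to [r], the law of cosines gives the abscissa of the third vertex. *)
Lemma triangle_exists (R : rcfType) (a t r : R) :
  0 <= a -> 0 <= t -> 0 <= r -> r <= a + t -> a <= r + t -> t <= a + r ->
  exists z : R[i], `|z| = a%:C%C /\ `|r%:C%C - z| = t%:C%C.
Proof.
move=> a0 t0 r0 rat art tar.
have [r00|rN0] := eqVneq r 0.
  exists a%:C%C; rewrite r00 sub0r normrN !normc_real //.
  by split=> //; congr _%:C%C; lra.
have r_gt0 : 0 < r by rewrite lt_def rN0.
pose x := (r ^+ 2 + a ^+ 2 - t ^+ 2) / (2 * r).
have xE : x * (2 * r) = r ^+ 2 + a ^+ 2 - t ^+ 2.
  by rewrite divfK // mulf_neq0 // pnatr_eq0.
have xa : x <= a.
  have : x * (2 * r) <= a * (2 * r) by rewrite xE; nra.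
  by rewrite ler_pM2r // mulr_gt0.
have ax : - a <= x.
  have : - a * (2 * r) <= x * (2 * r) by rewrite xE; nra.
  by rewrite ler_pM2r // mulr_gt0.
have y_ge0 : 0 <= a ^+ 2 - x ^+ 2 by nra.
exists (x +i* Num.sqrt (a ^+ 2 - x ^+ 2))%C; split; rewrite normc_def /=.
  by congr _%:C%C; rewrite sqr_sqrtr // addrC subrK sqrtr_sqr ger0_norm.
congr _%:C%C; rewrite sub0r sqrrN sqr_sqrtr //.
have -> : (r - x) ^+ 2 + (a ^+ 2 - x ^+ 2) = t ^+ 2 by nra.
by rewrite sqrtr_sqr ger0_norm.
Qed.

(** A polygon with one side on the real axis is cut by a diagonal of length [t]
    into a triangle with sides [a ord0], [t], [r] and a polygon with one side
    fewer.  The longest conceivable diagonal does the job: it may exceed neither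
    [a ord0 + r] nor the sum of the remaining sides. *)
Lemma polygon_exists (R : rcfType) (n : nat) (a : 'I_n -> R) (r : R) :
  (forall i, 0 <= a i) -> 0 <= r -> r <= \sum_i a i ->
  (forall i, a i *+ 2 <= r + \sum_i a i) ->
  exists z : 'I_n -> R[i], (forall i, `|z i| = (a i)%:C%C) /\
                           \sum_i z i = r%:C%C.
Proof.
elim: n a r => [|n IHn] a r a_ge0 r_ge0.
  rewrite big_ord0 => r_le0 _; exists (fun=> 0); split=> [[]//|].
  by rewrite big_ord0; have -> : r = 0 by apply/eqP; rewrite eq_le r_le0.
rewrite big_ord_recl; set b := a ord0; set s := \sum_i _ => rbs abs.
pose t : R := Num.min s (b + r).
have b_ge0 : 0 <= b := a_ge0 ord0.
have s_ge0 : 0 <= s by apply: sumr_ge0.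
have t_s : t <= s by rewrite ge_min lexx.
have t_br : t <= b + r by rewrite ge_min lexx orbT.
have le_t (y : R) : y <= s -> y <= b + r -> y <= t by rewrite le_min => -> ->.
have bb := abs ord0.
have t_ge0 : 0 <= t by apply: le_t; rewrite // addr_ge0.
have [||v [v_norm v_sum]] := IHn (fun i => a (lift ord0 i)) t _ t_ge0 t_s.
- by move=> i.
- move=> i; rewrite -/s -lerBlDr; apply: le_t; last first.
    by have := abs (lift ord0 i); lra.
  have : a (lift ord0 i) <= s.
    by rewrite /s (bigD1 i) //= lerDl sumr_ge0.
  lra.
have rbt : r <= b + t by rewrite -lerBlDl; apply: le_t; lra.
have brt : b <= r + t.
  by rewrite -lerBlDl; apply: le_t; move: bb; rewrite -/b; lra.
have [z0 [z0_norm]] := triangle_exists b_ge0 t_ge0 r_ge0 rbt brt t_br.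
case/phase_exists=> u u_norm uE.
exists (fun i => if unlift ord0 i is Some j then u * v j else z0); split.
  move=> i; case: unliftP => [j|] ->; last by [].
  by rewrite normrM u_norm mul1r v_norm.
rewrite big_ord_recl unlift_none.
under eq_bigr do rewrite liftK.
by rewrite -mulr_sumr v_sum uE addrC subrK.
Qed.

(** The polygon inequality, with each side added to both members so that the
    sum ranges over all sides. *)
Definition polygonal (R : numDomainType) (n : nat) (a : 'I_n -> R) : Prop :=
  forall i, a i *+ 2 <= \sum_k a k.

Lemma closed_polygon (R : rcfType) (n : nat) (a : 'I_n -> R) :
  (forall i, 0 <= a i) -> polygonal a ->
  exists z : 'I_n -> R[i], (forall i, `|z i| = (a i)%:C%C) /\ \sum_i z i = 0.
Proof.
move=> a_ge0 a_poly; apply: polygon_exists => // [|i].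
  exact: sumr_ge0.
by rewrite add0r.
Qed.

Lemma polygonal_norm (R : rcfType) (n : nat) (z : 'I_n -> R[i])
    (a : 'I_n -> R) :
  (forall i, `|z i| = (a i)%:C%C) -> \sum_i z i = 0 -> polygonal a.
Proof.
move=> z_norm z_sum i; rewrite (bigD1 i) //= mulr2n lerD2l -lecR.
rewrite -z_norm rmorph_sum /=.
have -> : z i = - \sum_(k | k != i) z k.
  by apply/eqP; rewrite -addr_eq0 -[X in _ == X]z_sum [X in _ == X](bigD1 i).
rewrite normrN (le_trans (ler_norm_sum _ _ _)) //.
by apply: ler_sum => k _; rewrite z_norm.
Qed.

(** * Phaseless rank deficiency *)

Definition polygonal_weights (R : numDomainType) (n m : nat)
    (A : 'M[R]_(n, m)) (j : 'I_m) (x : 'rV[R]_n) : Prop :=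
  polygonal (fun i => x 0 i * A i j).

Lemma convex_cone_polygonal_weights (R : numDomainType) (n m : nat)
    (A : 'M[R]_(n, m)) (j : 'I_m) :
  convex_cone (polygonal_weights A j).
Proof.
split=> [i|x y Px Py i|a x a_ge0 Px i] /=.
- rewrite mxE mul0r mul0rn; apply: sumr_ge0 => k _.
  by rewrite mxE mul0r.
- under eq_bigr do rewrite mxE mulrDl.
  by rewrite big_split /= mxE mulrDl mulrnDl lerD.
under eq_bigr do rewrite mxE -mulrA.
by rewrite -mulr_sumr mxE -mulrA -mulrnAr ler_wpM2l.
Qed.

Lemma phaseless_rank_lt_iff (R : realType) (n m : nat) (A : 'M[R]_(n, m)) :
  nonneg_mx A ->
  (phaseless_rank A < n)%N <->
  exists x, [/\ x != 0, nonneg_mx x & forall j, polygonal_weights A j x].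
Proof.
move=> A_ge0; split=> [ltAn|[x [x0 x_ge0 xP]]].
  have [B AB rankB] := phaseless_rank_attained A_ge0.
  have : kermx B != 0.
    by rewrite kermx_eq0 /row_free rankB neq_ltn ltAn.
  case/rowV0Pn=> w /sub_kermxP wB0 /rV0Pn[k wk0].
  pose x := \row_i complex.Re `|w 0 i|.
  have xE i : (x 0 i)%:C%C = `|w 0 i|.
    by rewrite mxE RRe_real // ger0_real.
  exists x; split=> [|i0 i|j].
  - apply/rV0Pn; exists k; apply: contra_neq wk0 => xk0.
    by apply/eqP; rewrite -normr_eq0 -xE xk0.
  - by rewrite (ord1 i0) -lecR xE normr_ge0.
  apply: (@polygonal_norm _ _ (fun i => w 0 i * B i j)) => [i|].
    by rewrite normrM AB rmorphM /= xE.
  by have := congr1 (fun M : 'rV_m => M 0 j) wB0; rewrite !mxE.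
have /choice[z zP] j : exists z : 'I_n -> R[i],
    (forall i, `|z i| = (x 0 i * A i j)%:C%C) /\ \sum_i z i = 0.
  by apply: closed_polygon (xP j) => i; apply: mulr_ge0.
(* Where x i = 0, the phase of B i j is immaterial. *)
pose B := \matrix_(i, j)
  if x 0 i == 0 then (A i j)%:C%C else z j i / (x 0 i)%:C%C.
have AB : has_modulus A B.
  move=> i j; rewrite mxE; case: eqVneq => [_|xi0]; first exact: normc_real.
  rewrite normrM normfV normc_real // (zP j).1 rmorphM /= mulrC mulKf //.
  by rewrite fmorph_eq0.
apply: leq_ltn_trans (phaseless_rank_le AB) _.
rewrite ltn_neqAle rank_leq_row andbT; apply: contra_neqN x0 => Bfree.
pose w := map_mx (fun a : R => a%:C%C) x.
have wB0 : w *m B = 0.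
  apply/rowP=> j; rewrite !mxE -[RHS](zP j).2; apply: eq_bigr => i _.
  rewrite !mxE; case: eqVneq => [xi0|xi0]; last first.
    by rewrite mulrC divfK // fmorph_eq0.
  by apply/esym/eqP; rewrite xi0 mul0r -normr_eq0 (zP j).1 xi0 mul0r.
have w0 : w = 0 by apply: (row_free_inj Bfree); rewrite wB0 mul0mx.
apply/rowP=> i; have := congr1 (fun M : 'rV_n => M 0 i) w0.
by rewrite !mxE => -[].
Qed.

Theorem proposition5p1 (R : realType) (n m : nat) (hnm : (n <= m)%N)
    (A : 'M[R]_(n, m)) (hA : nonneg_mx A) :
  (phaseless_rank A < n)%N <->
  (forall (I : {set 'I_m}) (cardI : #|I| = n),
     (phaseless_rank (col_submx A cardI) < n)%N).
Proof.
have AI_ge0 (I : {set 'I_m}) (cardI : #|I| = n) : nonneg_mx (col_submx A cardI).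
  by move=> i k; rewrite mxE.
have AIE (I : {set 'I_m}) (cardI : #|I| = n) k x :
    polygonal_weights (col_submx A cardI) k x =
    polygonal_weights A (enum_val (cast_ord (esym cardI) k)) x.
  by congr polygonal; apply/funext=> i; rewrite mxE.
split=> [/(phaseless_rank_lt_iff hA)[x [x0 x_ge0 xP]] I cardI|ltAIn].
  apply/phaseless_rank_lt_iff => //; exists x; split=> // k.
  by rewrite AIE.
apply/(phaseless_rank_lt_iff hA); apply: conic_helly.
- by rewrite card_ord.
- exact: convex_cone_polygonal_weights.
move=> I cardI.
have := ltAIn I cardI.
case/(phaseless_rank_lt_iff (AI_ge0 I cardI))=> x [x0 x_ge0 xP].
exists x; split=> // j jI.
have := xP (cast_ord cardI (enum_rank_in jI j)).
by rewrite AIE cast_ordK enum_rankK_in.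
Qed.
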